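(* Let $N\ge2$, $D\ge1$ be integers and let $H(D,N)$ be the Hamming graph. For $x\in\mathbb R$ the following are equivalent: (1) $x\in[-1/(N-1),1]$; (2) the function $f_x(i)=x^i$ ($i\in X=\{0,1,\dots,D\}$) is positive definite on the polynomial hypergroup $(X,* )$ associated with $H(D,N)$; (3) the kernel $Q_x(u,v)=x^{d(u,v)}$ (with $0^0=1$) is positive semidefinite on the vertex set of $H(D,N)$.
   Context: The Hamming graph $H(D,N)$ has vertex set $V=\{1,\dots,N\}^D$, two vertices adjacent iff they differ in exactly one coordinate; its distance is $d(u,v)=|\{i: u_i\ne v_i\}|$ and its diameter is $D$. It is distance-regular: for $i,j,k\in X$ the number $p_{i,j}^k=|\{z: d(x,z)=i,\ d(y,z)=j\}|$ is the same for all $x,y$ with $d(x,y)=k$. Let $\omega_k=p_{k,k}^0$ and $\tilde p_{i,j}^k=\frac{\omega_k}{\omega_i\omega_j}p_{i,j}^k$. The associated polynomial hypergroup $(X,* )$ is $X$ with convolution $\delta_i*\delta_j=\sum_k\tilde p_{i,j}^k\delta_k$. For $f:X\to\mathbb C$ write $f(i*j)=\sum_k\tilde p_{i,j}^kf(k)$; $f$ is positive definite on $(X,* )$ if $\sum_{k,l=1}^nc_k\bar c_lf(x_k*x_l)\ge0$ for all $n$, $x_k\in X$, $c_k\in\mathbb C$. A kernel $Q$ on $V$ is positive semidefinite if $\sum_{i,j}c_i\bar c_jQ(u_i,u_j)\ge0$ for all finite families of vertices $u_i$ and complex $c_i$. *)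

(* Defs.v *)
From HB Require Import structures.
From mathcomp Require Export all_boot all_order all_algebra all_fingroup.
From mathcomp Require Export reals.
From mathcomp Require Export complex.

Set Implicit Arguments.
Unset Strict Implicit.
Unset Printing Implicit Defensive.

Import Order.TTheory GRing.Theory Num.Theory.
Local Open Scope ring_scope.
Local Open Scope complex_scope.

Definition hvertex (D N : nat) : finType := {ffun 'I_D -> 'I_N}.

Definition hdist (D N : nat) (u v : hvertex D N) : nat :=
  #|[set i | u i != v i]|.

Definition hadj (D N : nat) : rel (hvertex D N) :=
  fun u v => hdist u v == 1%N.

(* The number p_{i,j}^k, read off an arbitrary pair of vertices at distance k;
   it is 0 if there is no such pair. Independence of the chosen pair is
   [inter_numE]. *)
Definition inter_num (D N i j k : nat) : nat :=
  if [pick xy : hvertex D N * hvertex D N | hdist xy.1 xy.2 == k] is Some xy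
  then #|[set z | hdist xy.1 z == i & hdist xy.2 z == j]|
  else 0%N.

Definition omega (D N k : nat) : nat := inter_num D N k k 0.

Definition tilde_p (R : realType) (D N i j k : nat) : R :=
  (omega D N k)%:R / ((omega D N i)%:R * (omega D N j)%:R)
  * (inter_num D N i j k)%:R.

(* f(i * j), i.e. f integrated against delta_i * delta_j. *)
Definition hconv (R : realType) (D N : nat) (f : 'I_D.+1 -> R[i])
    (i j : 'I_D.+1) : R[i] :=
  \sum_(k < D.+1) (tilde_p R D N i j k)%:C * f k.

(* On R[i], [0 <= z] means that z is real and nonnegative. *)
Definition hg_posdef (R : realType) (D N : nat) (f : 'I_D.+1 -> R[i]) : Prop :=
  forall (n : nat) (x : 'I_n -> 'I_D.+1) (c : 'I_n -> R[i]),
    0 <= \sum_(k < n) \sum_(l < n)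
           c k * (c l)^* * hconv N f (x k) (x l).

Definition kernel_psd (R : realType) (V : Type) (Q : V -> V -> R[i]) : Prop :=
  forall (n : nat) (u : 'I_n -> V) (c : 'I_n -> R[i]),
    0 <= \sum_(k < n) \sum_(l < n) c k * (c l)^* * Q (u k) (u l).

Lemma hdist_sym (D N : nat) (u v : hvertex D N) : hdist u v = hdist v u.
Proof. by apply: eq_card => i; rewrite !inE eq_sym. Qed.

Lemma hdist_eq0 (D N : nat) (u v : hvertex D N) : (hdist u v == 0%N) = (u == v).
Proof.
rewrite cards_eq0; apply/eqP/eqP => [h|->]; last first.
  by apply/setP => i; rewrite !inE eqxx.
by apply/ffunP => i; have /setP/(_ i) := h; rewrite !inE => /negbFE/eqP.
Qed.

Lemma hdist_triangle (D N : nat) (u v w : hvertex D N) :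
  (hdist u w <= hdist u v + hdist v w)%N.
Proof.
apply: leq_trans (leq_card_setU _ _).
apply/subset_leq_card/subsetP => i; rewrite !inE -negb_and.
by apply: contra => /andP[/eqP-> /eqP->].
Qed.

(* [hdist] is the graph distance of [hadj]: no walk from u to v is shorter than
   hdist u v, and some walk has exactly that length. *)
Lemma hdist_walk_ge (D N : nat) (u : hvertex D N) (p : seq (hvertex D N)) :
  path (@hadj D N) u p -> (hdist u (last u p) <= size p)%N.
Proof.
elim: p u => [|v p IH] u /=; first by move=> _; rewrite leqn0 hdist_eq0.
case/andP=> /eqP uv /IH vp.
by apply: leq_trans (hdist_triangle u v _) _; rewrite uv ltnS.
Qed.

Lemma hdist_walk_ex (D N : nat) (u v : hvertex D N) :
  exists p, [/\ path (@hadj D N) u p, last u p = v & size p = hdist u v].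
Proof.
move en: (hdist u v) => n; elim: n u en => [|n IH] u en.
  by exists [::]; split=> //=; apply/eqP; rewrite -hdist_eq0 en.
have /card_gt0P [m] : (0 < #|[set i | u i != v i]|)%N by rewrite -/(hdist u v) en.
rewrite inE => um.
pose w : hvertex D N := [ffun j => if j == m then v m else u j].
have uw : hdist u w = 1%N.
  rewrite -(cards1 m); apply: eq_card => j; rewrite !inE ffunE.
  by case: (eqVneq j m) => [->|]; rewrite // eqxx.
have wv : hdist w v = n.
  have := en; rewrite /hdist (cardsD1 m) inE um /= => -[<-].
  apply: eq_card => j; rewrite !inE ffunE.
  by case: (eqVneq j m) => [->|]; rewrite // eqxx.
have [p [pp lp sp]] := IH _ wv.
by exists (w :: p); rewrite /= /hadj uw eqxx sp.
Qed.

Lemma hdist_automorphism (D N : nat) (x y x' y' : hvertex D N) :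
  hdist x y = hdist x' y' ->
  exists h : hvertex D N -> hvertex D N,
    [/\ h x' = x, h y' = y & forall u v, hdist (h u) (h v) = hdist u v].
Proof.
move=> exy.
pose s (u v : hvertex D N) := [tuple u i != v i | i < D].
have cs u v : count_mem true (s u v) = hdist u v.
  rewrite /hdist cardsE cardE /enum_mem size_filter /= count_map.
  by rewrite enumT; apply: eq_count => i /=; rewrite eqb_id.
have /tuple_permP[p /= es] : perm_eq (s x y) (s x' y').
  have cf (t : D.-tuple bool) : count_mem false t = (D - count_mem true t)%N.
    have := size_tuple t; rewrite -(count_predC (pred1 true) t) => eD.
    by rewrite -[X in (X - _)%N]eD addKn; apply: eq_count => -[].
  by apply/allP => b _; apply/eqP; case: b; rewrite ?cf !cs exy.
have ep i : (x i == y i) = (x' (p i) == y' (p i)).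
  apply: negb_inj; have /(congr1 (fun t => tnth t i)) :
     s x y = [tuple tnth (s x' y') (p i) | i < D] by apply: val_inj.
  by rewrite !tnth_mktuple.
pose t i : {perm 'I_N} := let t1 := tperm (x' (p i)) (x i) in
  (t1 * tperm (t1 (y' (p i))) (y i))%g.
exists (fun z => [ffun i => t i (z (p i))]); split.
- apply/ffunP => i; rewrite ffunE /t permM tpermL.
  have := ep i; case: (eqVneq (x i) (y i)) => [exi /esym/eqP <-|nxy /esym n'].
    by rewrite !tpermL exi.
  rewrite [LHS]tpermD //; last by rewrite eq_sym.
  by rewrite -[X in _ != X](tpermL (x' (p i))) (inj_eq perm_inj) eq_sym n'.
- by apply/ffunP => i; rewrite ffunE /t permM tpermL.
move=> u v; rewrite /hdist -[RHS](on_card_preimset (f := p)); last first.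
  by apply: onW_bij; exists (p^-1)%g; [apply: permK | apply: permKV].
by apply: eq_card => i; rewrite !inE !ffunE (inj_eq perm_inj).
Qed.

Lemma inter_numE (D N i j k : nat) (x y : hvertex D N) :
  hdist x y = k ->
  inter_num D N i j k = #|[set z | hdist x z == i & hdist y z == j]|.
Proof.
rewrite /inter_num => xyk; case: pickP => [[x' y'] /= /eqP e|/(_ (x, y))]; last first.
  by rewrite /= xyk eqxx.
have [h [hx hy hd]] := hdist_automorphism (etrans xyk (esym e)).
have hinj : injective h.
  by move=> u v huv; apply/eqP; rewrite -hdist_eq0 -hd huv hdist_eq0.
rewrite -[RHS](on_card_preimset (f := h)).
  by apply: eq_card => z; rewrite !inE -hx -hy !hd.
exact/onW_bij/injF_bij.
Qed.

(* Main.v *)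
Require Import Defs.
From mathcomp Require Import all_boot all_order all_algebra.
From mathcomp Require Import reals complex.
From mathcomp Require Import ring lra.

Import Order.TTheory GRing.Theory Num.Theory.
Local Open Scope ring_scope.
Local Open Scope complex_scope.

(** Write J for the all-ones matrix of size N and K = (1 - x) I + x J, whose
    eigenvalues are 1 - x and 1 + (N - 1) x.  The kernel x^d(u,v) is the D-fold
    tensor power of K, so when both eigenvalues are nonnegative it is the Gram
    kernel of the tensor power of the square root of K: (1) implies (3).
    Since f(i * j) is the mean of f(d(u,v)) over u and v in the spheres of radii i
    and j around a vertex, testing (3) on functions of the distance to that vertex
    gives (2).  Finally the positivity of the 2x2 matrix f(i * j), i, j in {0, 1},
    already forces (1 - x) (1 + (N - 1) x) >= 0, that is (1). *)

(** * Positive semidefiniteness of the kernel x^d(u,v) *)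

Lemma conj_real_complex (R : realType) (x : R) : (x%:C)^*%R = x%:C.
Proof. exact: conjc_real. Qed.

(** The quadratic form is the sum over s of the squared moduli of the sums of c_k g_s(u_k). *)
Lemma kernel_psd_gram (R : realType) (V : Type) (S : finType)
    (g : S -> V -> R) (Q : V -> V -> R[i]) :
  (forall u v, Q u v = (\sum_s g s u * g s v)%:C) -> kernel_psd Q.
Proof.
move=> QE n u c.
have -> : \sum_(k < n) \sum_(l < n) c k * (c l)^* * Q (u k) (u l) =
    \sum_s (\sum_(k < n) c k * (g s (u k))%:C)
           * (\sum_(k < n) c k * (g s (u k))%:C)^*.
  under [RHS]eq_bigr => s _ do rewrite rmorph_sum /= big_distrlr /=.
  rewrite [RHS]exchange_big; apply: eq_bigr => k _ /=.
  rewrite [RHS]exchange_big; apply: eq_bigr => l _ /=.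
  rewrite QE rmorph_sum mulr_sumr; apply: eq_bigr => s _.
  by rewrite !rmorphM /= conj_real_complex; ring.
by apply: sumr_ge0 => s _; exact: mul_conjC_ge0.
Qed.

Lemma kernel_psd_fin (R : realType) (V : Type) (Q : V -> V -> R[i])
    (I : finType) (u : I -> V) (c : I -> R[i]) :
  kernel_psd Q -> 0 <= \sum_k \sum_l c k * (c l)^* * Q (u k) (u l).
Proof.
move=> /(_ #|I| (u \o enum_val) (c \o enum_val)) /=.
rewrite [leRHS](_ : _ = \sum_k \sum_l c k * (c l)^* * Q (u k) (u l)) //.
rewrite [RHS](reindex (@enum_val I predT)) /=; last exact/onW_bij/enum_val_bij.
apply: eq_bigr => k _.
by rewrite [RHS](reindex (@enum_val I predT)) //; exact/onW_bij/enum_val_bij.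
Qed.

Lemma expr_hdist (R : realType) (D N : nat) (u v : hvertex D N) (x : R) :
  x ^+ hdist u v = \prod_i (if u i == v i then 1 else x).
Proof.
rewrite /hdist -prodr_const big_mkcond /=; apply: eq_bigr => i _.
by rewrite inE; case: (u i == v i).
Qed.

Lemma hamming_kernel_psd (R : realType) (N D : nat) (x : R) :
    (0 < N)%N -> 0 <= 1 - x -> 0 <= 1 + (N%:R - 1) * x ->
  kernel_psd (fun u v : hvertex D N => (x ^+ hdist u v)%:C).
Proof.
move=> N0 mu0 la0.
(* [a I + b J] is the square root of K. *)
pose a := Num.sqrt (1 - x).
pose b := (Num.sqrt (1 + (N%:R - 1) * x) - a) / N%:R.
pose B (s t : 'I_N) : R := (if s == t then a else 0) + b.
have NR : (N%:R : R) != 0 by rewrite pnatr_eq0 -lt0n.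
have a2 : a ^+ 2 = 1 - x by rewrite sqr_sqrtr.
(* Since a + N b is the square root of 1 + (N - 1) x, the left side is ((a + N b)^2 - a^2) / N. *)
have ab : 2 * a * b + N%:R * b ^+ 2 = x.
  have -> : 2 * a * b + N%:R * b ^+ 2 =
      (Num.sqrt (1 + (N%:R - 1) * x) ^+ 2 - a ^+ 2) / N%:R.
    by rewrite /b; field.
  by rewrite a2 sqr_sqrtr //; field.
(* Entrywise form of B^2 = K, from J^2 = N J: the diagonal entry is a^2 + x = 1. *)
have BE s t : \sum_r B r s * B r t = if s == t then 1 else x.
  have -> : \sum_r B r s * B r t = \sum_r (if r == s then
       (if s == t then a ^+ 2 else 0) else 0) + \sum_r (if r == s then a * b else 0)
       + \sum_r (if r == t then a * b else 0) + \sum_(r < N) b ^+ 2.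
    rewrite -!big_split; apply: eq_bigr => r _; rewrite /B /=.
    case: (eqVneq r s) => [->|_]; first by case: (s == t); ring.
    by case: (r == t); ring.
  rewrite -!big_mkcond !big_pred1_eq sumr_const card_ord -mulr_natl.
  by case: (s == t); lra.
(* The Gram vectors are the columns of the D-fold tensor power of B. Distributing the product over
   coordinates turns the D sums of [BE] into one sum over functions s. *)
apply: (@kernel_psd_gram _ _ {ffun 'I_D -> 'I_N}
  (fun s (u : hvertex D N) => \prod_i B (s i) (u i))) => u v.
congr (_%:C); rewrite expr_hdist.
under eq_bigr => i _ do rewrite -BE.
rewrite bigA_distr_bigA; apply: eq_bigr => s _; exact: big_split.
Qed.

(** * From kernels on vertices to functions on the hypergroup *)

Lemma card_sphere (D N k : nat) (u : hvertex D N) :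
  #|[set v | hdist u v == k]| = omega D N k.
Proof.
rewrite /omega (@inter_numE _ _ _ _ _ u u); last by apply/eqP; rewrite hdist_eq0.
by apply: eq_card => v; rewrite !inE andbb.
Qed.

Lemma hdist_max (D N : nat) (u v : hvertex D N) : (hdist u v < D.+1)%N.
Proof. by rewrite ltnS -[D in leqRHS]card_ord max_card. Qed.

(* Averaging over the base vertex o replaces the identity
   omega_k p_{i,j}^k = omega_i p_{j,k}^i by an exchange of summations. *)
Lemma hconv_average (R : realType) (D N : nat) (g : nat -> R[i]) (i j : 'I_D.+1) :
  #|hvertex D N|%:R * hconv N (fun k : 'I_D.+1 => g k) i j =
  \sum_(o : hvertex D N) \sum_(u | hdist o u == i) \sum_(v | hdist o v == j)
     ((omega D N i)%:R^-1 * (omega D N j)%:R^-1) * g (hdist u v).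
Proof.
set w := _^-1 * _^-1.
have -> : \sum_(o : hvertex D N) \sum_(u | hdist o u == i)
    \sum_(v | hdist o v == j) w * g (hdist u v) =
    \sum_(u : hvertex D N) \sum_v
      w * (inter_num D N i j (hdist u v))%:R * g (hdist u v).
  (* With o summed innermost, each pair u, v contributes the number of o at distance i from u and j
     from v. *)
  under eq_bigr => o _ do rewrite big_mkcond.
  rewrite exchange_big; apply: eq_bigr => u _ /=.
  under eq_bigr => o _ do rewrite big_mkcond /=.
  have -> : \sum_(o : hvertex D N) (if hdist o u == i then
      \sum_v (if hdist o v == j then w * g (hdist u v) else 0) else 0) =
     \sum_o \sum_v (if (hdist o u == i) && (hdist o v == j)
                    then w * g (hdist u v) else 0).
    apply: eq_bigr => o _; case: (hdist o u == i) => //=.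
    by rewrite big1.
  rewrite exchange_big; apply: eq_bigr => v _ /=.
  rewrite (@inter_numE _ _ _ _ _ u v) // -big_mkcond /= sumr_const.
  rewrite -[RHS]mulrA [_%:R * _]mulr_natl -mulrnAr; congr (_ * (_ *+ _)).
  by apply: eq_card => o; rewrite inE unfold_in /= !(hdist_sym o).
rewrite -sum1_card natr_sum mulr_suml; apply: eq_bigr => u _; rewrite mul1r.
(* For fixed u, the vertices v are grouped by their distance k to u, with [omega D N k] of them in
   each class. *)
rewrite (partition_big (fun v => Ordinal (hdist_max D N u v)) predT) //=.
apply: eq_bigr => k _.
rewrite (eq_bigr (fun=> w * (inter_num D N i j k)%:R * g k)); last first.
  by move=> v /eqP <-.
rewrite sumr_const -mulr_natl.
have -> : #|fun v => Ordinal (hdist_max D N u v) == k| = omega D N k.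
  by rewrite -(card_sphere _ _ _ u); apply: eq_card => v; rewrite inE.
rewrite /tilde_p /w !rmorphM /= fmorphV rmorphM !rmorph_nat invfM.
by ring.
Qed.

Lemma card_hvertex_gt0 (D N : nat) : (0 < N)%N -> (0 < #|hvertex D N|)%N.
Proof. by move=> N0; rewrite card_ffun card_ord expn_gt0 N0. Qed.

Lemma kernel_psd_hg_posdef (R : realType) (N D : nat) (g : nat -> R[i]) :
    (0 < N)%N ->
    kernel_psd (fun u v : hvertex D N => g (hdist u v)) ->
  hg_posdef N (fun k : 'I_D.+1 => g k).
Proof.
move=> N0 gpsd n x c.
have V0 : 0 < (#|hvertex D N|%:R : R[i]).
  by rewrite ltr0n card_hvertex_gt0.
rewrite -(pmulr_rge0 _ V0).
(* The coefficient c_k is spread evenly over the sphere of radius x_k around o. Pairs (k, u) serve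
   as indices because the spheres for different k may coincide. *)
pose c' (o : hvertex D N) (p : 'I_n * hvertex D N) : R[i] :=
  if hdist o p.2 == x p.1 then c p.1 / (omega D N (x p.1))%:R else 0.
rewrite [leRHS](_ : _ = \sum_o \sum_p \sum_q
   c' o p * (c' o q)^* * g (hdist p.2 q.2)); last first.
  rewrite mulr_sumr.
  have -> : \sum_o \sum_p \sum_q c' o p * (c' o q)^* * g (hdist p.2 q.2) =
    \sum_o \sum_k \sum_u \sum_l \sum_v
       c' o (k, u) * (c' o (l, v))^* * g (hdist u v).
    apply: eq_bigr => o _; rewrite [RHS]pair_bigA; apply: eq_bigr => -[k u] _ /=.
    by rewrite [RHS]pair_bigA; apply: eq_bigr => -[l v] _ /=.
  rewrite [RHS]exchange_big; apply: eq_bigr => k _ /=.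
  under [RHS]eq_bigr => o _ do rewrite exchange_big /=.
  rewrite [RHS]exchange_big mulr_sumr; apply: eq_bigr => l _ /=.
  rewrite mulrCA hconv_average mulr_sumr; apply: eq_bigr => o _ /=.
  rewrite mulr_sumr big_mkcond; apply: eq_bigr => u _ /=.
  rewrite /c' /=; case: (hdist o u == x k); last first.
    by rewrite big1 // => v _; rewrite !mul0r.
  rewrite mulr_sumr big_mkcond; apply: eq_bigr => v _ /=.
  case: (hdist o v == x l); last by rewrite rmorph0 mulr0 mul0r.
  by rewrite rmorphM fmorphV rmorph_nat; ring.
by apply: sumr_ge0 => o _; exact: (@kernel_psd_fin _ _ _ _ snd (c' o) gpsd).
Qed.

(** * Spheres of radius 0 and 1 *)

Definition hupdate {D N : nat} (o : hvertex D N) (i : 'I_D) (a : 'I_N) :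
  hvertex D N := [ffun j => if j == i then a else o j].

Lemma big_sphere0 (S : nmodType) (D N : nat) (o : hvertex D N)
    (F : hvertex D N -> S) :
  \sum_(u | hdist o u == 0%N) F u = F o.
Proof.
by rewrite (eq_bigl (pred1 o)) ?big_pred1_eq // => u; rewrite hdist_eq0 eq_sym.
Qed.

Lemma hdist_hupdate (D N : nat) (o : hvertex D N) i a :
  hdist o (hupdate o i a) = (o i != a).
Proof.
case: (eqVneq (o i) a) => [<-|oa] /=; apply/eqP.
  rewrite hdist_eq0; apply/eqP/ffunP => j; rewrite ffunE.
  by case: eqVneq => // ->.
apply/eqP; rewrite -(cards1 i); apply: eq_card => j; rewrite !inE ffunE.
by case: (eqVneq j i) => [->|]; rewrite // eqxx.
Qed.

(** A vertex at distance 1 from o is determined by the one coordinate where it differs and its value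
    there. *)
Lemma big_sphere1 (S : nmodType) (D N : nat) (o : hvertex D N)
    (F : hvertex D N -> S) :
  \sum_(u | hdist o u == 1%N) F u =
  \sum_i \sum_(a | a != o i) F (hupdate o i a).
Proof.
rewrite pair_big_dep /=.
(* For D = 0 both sums are empty; D > 0 supplies the default coordinate [ord0] in [d]. *)
case: D o F => [|D] o F.
  rewrite big1 => [|u]; first by rewrite big1 // => -[[]].
  by rewrite /hdist => /eqP h; have := max_card [set i | o i != u i];
     rewrite h card_ord.
pose d (u : hvertex D.+1 N) := odflt ord0 [pick i | o i != u i].
rewrite (reindex_onto (fun p => hupdate o p.1 p.2) (fun u => (d u, u (d u)))).
  apply: eq_bigl => -[i a] /=; rewrite hdist_hupdate eqb1 eq_sym.
  case: (eqVneq a (o i)) => //= aoi.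
  apply/eqP; suff -> : d (hupdate o i a) = i by rewrite ffunE eqxx.
  rewrite /d; case: pickP => [j|/(_ i)] /=; rewrite ffunE ?eqxx.
    by case: (eqVneq j i) => //; rewrite eqxx.
  by rewrite eq_sym aoi.
move=> u /cards1P [i e].
have di : d u = i.
  rewrite /d; case: pickP => [j|/(_ i)].
    by have /setP/(_ j) := e; rewrite !inE => -> /eqP.
  by have /setP/(_ i) := e; rewrite !inE eqxx => ->.
apply/ffunP => j; rewrite di ffunE.
have /setP/(_ j) := e; rewrite !inE; case: (eqVneq j i) => [->//|_].
by move=> /negbFE/eqP.
Qed.

Lemma hdist_hupdate2 (D N : nat) (o : hvertex D N) i j a b :
    a != o i -> b != o j ->
  hdist (hupdate o i a) (hupdate o j b) =
  if i == j then (a != b) : nat else 2%N.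
Proof.
move=> ai bj; case: (eqVneq i j) => [ij|ij].
  rewrite -ij in bj *.
  have -> : hupdate o i b = hupdate (hupdate o i a) i b.
    by apply/ffunP => k; rewrite !ffunE; case: eqP.
  by rewrite hdist_hupdate ffunE eqxx.
have -> : 2%N = #|[set i; j]| by rewrite cards2 ij.
apply: eq_card => k; rewrite !inE !ffunE.
case: (eqVneq k i) => [->|ki]; first by rewrite (negbTE ij).
by case: (eqVneq k j) => [->|kj]; rewrite ?eqxx // eq_sym.
Qed.

Lemma omega0 (D N : nat) (N0 : (0 < N)%N) : omega D N 0 = 1%N.
Proof.
rewrite -(card_sphere _ _ _ [ffun=> Ordinal N0]) -sum1dep_card.
exact: (@big_sphere0 nat).
Qed.

Lemma sum_neq_ord (S : nmodType) (N : nat) (b : 'I_N) (z : S) :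
  \sum_(a | a != b) z = z *+ N.-1.
Proof. by rewrite sumr_const cardC1 card_ord. Qed.

Lemma omega1 (D N : nat) (N0 : (0 < N)%N) : omega D N 1 = (D * N.-1)%N.
Proof.
rewrite -(card_sphere _ _ _ [ffun=> Ordinal N0]) -sum1dep_card.
rewrite (@big_sphere1 nat).
under eq_bigr => i _ do rewrite (@sum_neq_ord nat).
rewrite sumr_const card_ord; ring.
Qed.

(** When the double sphere sum is the same for every centre o, the average over o in [hconv_average]
    can be computed at a single one. *)
Lemma hconv_sphere_sum (R : realType) (D N : nat) (g : nat -> R[i])
    (i j : 'I_D.+1) (z : R[i]) :
    (0 < N)%N -> (0 < omega D N i)%N -> (0 < omega D N j)%N ->
    (forall o : hvertex D N,
      \sum_(u | hdist o u == i) \sum_(v | hdist o v == j) g (hdist u v) =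
      (omega D N i)%:R * (omega D N j)%:R * z) ->
  hconv N (fun k : 'I_D.+1 => g k) i j = z.
Proof.
move=> N0 wi wj gE.
have V0 : (#|hvertex D N|%:R : R[i]) != 0.
  by rewrite pnatr_eq0 -lt0n card_hvertex_gt0.
have wi0 : ((omega D N i)%:R : R[i]) != 0 by rewrite pnatr_eq0 -lt0n.
have wj0 : ((omega D N j)%:R : R[i]) != 0 by rewrite pnatr_eq0 -lt0n.
apply: (mulfI V0); rewrite hconv_average mulr_natl -sumr_const.
apply: eq_bigr => o _.
under eq_bigr => u _ do rewrite -mulr_sumr.
by rewrite -mulr_sumr gE; field; rewrite wi0 wj0.
Qed.

(** * The matrix f(i * j) for i, j in {0, 1} *)

Section SmallDistances.
Variables (R : realType) (N D : nat) (x : R).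
Hypotheses (hN : (2 <= N)%N) (hD : (1 <= D)%N).

Local Notation g := (fun k : nat => (x ^+ k)%:C).
Local Notation f := (fun k : 'I_D.+1 => (x ^+ k)%:C).
Local Notation one := (inord 1 : 'I_D.+1).

Let N0 : (0 < N)%N. Proof. exact: ltnW. Qed.
Let w1 : (0 < omega D N 1)%N.
Proof. by rewrite omega1 // muln_gt0 hD -subn1 subn_gt0. Qed.
(** [hD] puts 1 in range, so [inord] does not return its default value. *)
Let oneE : one = 1%N :> nat. Proof. by rewrite inordK. Qed.

Lemma hconv_expr00 : hconv N f ord0 ord0 = 1.
Proof.
apply: (hconv_sphere_sum _ _ _ g); rewrite ?omega0 // => o.
rewrite !big_sphere0 (_ : hdist o o = 0%N) ?expr0; last first.
  by apply/eqP; rewrite hdist_eq0.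
by rewrite !mul1r.
Qed.

Lemma hconv_expr01 : hconv N f ord0 one = x%:C.
Proof.
apply: (hconv_sphere_sum _ _ _ g); rewrite ?oneE ?omega0 // => o.
rewrite big_sphere0 mul1r (eq_bigr (fun=> x%:C)) => [|v /eqP->]; last by [].
by rewrite sumr_const mulr_natl -(card_sphere _ _ _ o) cardsE.
Qed.

Lemma hconv_expr10 : hconv N f one ord0 = x%:C.
Proof.
apply: (hconv_sphere_sum _ _ _ g); rewrite ?oneE ?omega0 // => o.
rewrite mulr1 (eq_bigr (fun=> x%:C)) => [|v /eqP hv]; last first.
  by rewrite big_sphere0 hdist_sym hv.
by rewrite sumr_const mulr_natl -(card_sphere _ _ _ o) cardsE.
Qed.

(** Fix u on the unit sphere around o. Of the D (N - 1) vertices v there, one is u itself, N - 2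
    change the same coordinate as u (distance 1), and (D - 1) (N - 1) change another one (distance
    2). *)
Lemma hconv_expr11 :
  hconv N f one one =
  ((1 + (N%:R - 2) * x + (D%:R - 1) * (N%:R - 1) * x ^+ 2)
     / (D%:R * (N%:R - 1)))%:C.
Proof.
have DR : (D%:R : R) != 0 by rewrite pnatr_eq0 -lt0n.
have NR : (N%:R - 1 : R) != 0 by rewrite subr_eq0 pnatr_eq1 gtn_eqF.
have N1 : (N.-1%:R : R) = N%:R - 1 by rewrite -subn1 natrB.
have N2 : (N.-2%:R : R) = N%:R - 2 by rewrite -subn2 natrB.
have D1 : (D.-1%:R : R) = D%:R - 1 by rewrite -subn1 natrB.
apply: (hconv_sphere_sum _ _ _ g); rewrite ?oneE // => o.
rewrite omega1 // -!(rmorph_nat (real_complex R)) natrM N1 -!rmorphM /=.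
have inner i a : a != o i ->
    \sum_(v | hdist o v == 1%N) (x ^+ hdist (hupdate o i a) v) =
    1 + (N%:R - 2) * x + (D%:R - 1) * (N%:R - 1) * x ^+ 2.
  move=> ai; rewrite big_sphere1 (bigD1 i) //=; congr (_ + _).
    rewrite (bigD1 a) //= (eq_bigr (fun=> x)); last first.
      move=> b /andP[bi ba].
      by rewrite hdist_hupdate2 // eqxx eq_sym ba.
    rewrite hdist_hupdate2 // !eqxx /= expr0; congr (_ + _).
    rewrite sumr_const -[LHS]mulr_natl -N2; congr (_%:R * _).
    have := cardsC [set a; o i]; rewrite cards2 ai card_ord => /(congr1 (subn^~ 2)).
    rewrite addKn subn2 => <-.
    by apply: eq_card => b; rewrite !inE unfold_in negb_or andbC.
  rewrite (eq_bigr (fun=> (N%:R - 1) * x ^+ 2)); last first.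
    move=> j ji; rewrite (eq_bigr (fun=> x ^+ 2)) => [|b bj].
      by rewrite sum_neq_ord -N1 mulr_natl.
    by rewrite hdist_hupdate2 // eq_sym (negbTE ji).
  by rewrite sum_neq_ord -[LHS]mulr_natl D1 mulrA.
under eq_bigr => u _ do rewrite -rmorph_sum.
rewrite -rmorph_sum; congr (_%:C); rewrite big_sphere1.
under eq_bigr => i _.
  under eq_bigr => a ai do rewrite inner //.
  rewrite sum_neq_ord.
  over.
rewrite /= sumr_const card_ord -[LHS]mulr_natl -[X in _ * X = _]mulr_natl N1.
by field; rewrite DR NR.
Qed.

(* The 2x2 determinant f(0*0) f(1*1) - f(0*1)^2 equals
   (1 - x) (1 + (N - 1) x) / (D (N - 1)). *)
Lemma hg_posdef_expr_bounds :
  hg_posdef N f -> 0 <= (1 - x) * (1 + (N%:R - 1) * x).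
Proof.
(* The coefficients (-x, 1) minimize the form for last coefficient 1, because f(0*0) = 1 and f(0*1)
   = x; the value is f(1*1) - x^2, the determinant. *)
pose y (k : 'I_2) := if k == ord0 then ord0 else one.
pose c (k : 'I_2) := if k == ord0 then (- x)%:C else 1%:C.
move=> /(_ _ y c); rewrite !big_ord_recl !big_ord0 /y /c /=.
rewrite hconv_expr00 hconv_expr01 hconv_expr10 hconv_expr11.
rewrite !conj_real_complex mulr1 !addr0 -!(rmorphM, rmorphD) /=.
have N1 : 0 < (N%:R - 1 : R) by rewrite subr_gt0 ltr1n.
have D1 : 0 < (D%:R : R) by rewrite ltr0n.
have e : 0 < D%:R * (N%:R - 1) :> R by rewrite mulr_gt0.
rewrite ler0c -(pmulr_rge0 _ e); congr (0 <= _).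
by field; rewrite !lt0r_neq0.
Qed.

End SmallDistances.

Theorem theorem4p1 (R : realType) (N D : nat) (hN : (2 <= N)%N) (hD : (1 <= D)%N)
    (x : R) :
  [<-> - 1 / (N%:R - 1) <= x <= 1 ;
       hg_posdef N (fun i : 'I_D.+1 => (x ^+ i)%:C) ;
       kernel_psd (fun u v : hvertex D N => (x ^+ hdist u v)%:C) ].
Proof.
have N0 : (0 < N)%N by exact: ltnW.
have N1 : 1 <= (N%:R - 1 : R) by rewrite lerBrDr -(natrD _ 1 1) ler_nat.
have pd_bnd : hg_posdef N (fun i : 'I_D.+1 => (x ^+ i)%:C) ->
    - 1 / (N%:R - 1) <= x <= 1.
  move=> /(hg_posdef_expr_bounds _ _ _ _ hN hD) h.
  rewrite ler_pdivrMr; last by lra.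
  (* Outside the interval exactly one factor is negative: 1 - x for x above 1, and 1 + (N - 1) x for
     x below -1 / (N - 1). *)
  have [x1|x1] := leP x 1; last first.
    have : 0 < (x - 1) * (1 + (N%:R - 1) * x) by rewrite mulr_gt0 //; nra.
    by lra.
  rewrite andbT; apply: contraT; rewrite -ltNge => xN.
  have x0 : x < 1 by rewrite lt_neqAle x1 andbT; apply: contraTN xN => /eqP->; lra.
  have : 0 < (1 - x) * (- 1 - x * (N%:R - 1)) by rewrite mulr_gt0 //; lra.
  by lra.
have bnd_psd : - 1 / (N%:R - 1) <= x <= 1 ->
    kernel_psd (fun u v : hvertex D N => (x ^+ hdist u v)%:C).
  rewrite ler_pdivrMr; last by lra.
  by move=> /andP[h1 h2]; apply: hamming_kernel_psd => //; lra.
have psd_pd := @kernel_psd_hg_posdef R N D (fun k => (x ^+ k)%:C) N0.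
(* The proved implications run (1), (3), (2), (1), while [tfae] asks for the cycle (1), (2), (3),
   (1), so each goal is a composite of two of them. *)
by tfae => [/bnd_psd/psd_pd|/pd_bnd/bnd_psd|/psd_pd/pd_bnd].
Qed.
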